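(* Let $(S,\tau)$ be a band of topological groups. Then $(S,\tau)$ is metrizable if and only if each $\mathcal{H}$-class of $S$ (with the subspace topology) is metrizable.
   Context: A topological semigroup is a semigroup $S$ with a topology such that $(x,y)\mapsto xy$, $S\times S\to S$, is continuous. A band is a semigroup in which every element is idempotent; a band congruence on $S$ is a congruence $\rho$ with $S/\rho$ a band. A topological semigroup $(S,\tau)$ is a band $B$ of topological groups $(G_\alpha,\tau_\alpha)$ $(\alpha\in B)$ if $S$ admits a band congruence $\rho$ such that $S/\rho=B$, each $G_\alpha$ is a topological group (under the operation of $S$ and the topology $\tau_\alpha$) that is the $\rho$-class mapped onto $\alpha$ by the natural epimorphism $S\to B$, and $\bigcup_{\alpha\in B}\tau_\alpha$ is a base for $\tau$. ''Band of topological groups'' means a band $B$ of topological groups for some $B$ and some $(G_\alpha,\tau_\alpha)$. Green's relations are: $a\,\mathcal{L}\,b$ iff $Sa=Sb$; $a\,\mathcal{R}\,b$ iff $aS=bS$; $\mathcal{H}=\mathcal{L}\cap\mathcal{R}$. *)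

(* Defs.v *)
From HB Require Import structures.
From Stdlib Require Import RelationClasses.
From mathcomp Require Import all_boot all_order all_algebra.
From mathcomp Require Import all_classical all_reals topology.

Set Implicit Arguments.
Unset Strict Implicit.
Unset Printing Implicit Defensive.

Import Order.TTheory GRing.Theory Num.Theory.

Local Open Scope classical_set_scope.
Local Open Scope group_scope.

HB.mixin Record isTopologicalSemigroup S & Semigroup S & Topological S := {
  mulg_continuous : continuous (fun p : S * S => p.1 * p.2)
}.

#[short(type="topologicalSemigroupType")]
HB.structure Definition TopologicalSemigroup :=
  { S of Semigroup S & Topological S & isTopologicalSemigroup S }.

Section Metrizable.
Local Open Scope ring_scope.

Definition is_metric (R : realType) (T : Type) (d : T -> T -> R) : Prop :=
  [/\ forall x y, d x y = 0 <-> x = y,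
      forall x y, d x y = d y x &
      forall x y z, d x z <= d x y + d y z].

Definition metrizable (R : realType) (T : topologicalType) : Prop :=
  exists d : T -> T -> R, is_metric d /\
    forall U : set T, open U <->
      (forall x, U x -> exists2 e : R, 0 < e & [set y | d x y < e] `<=` U).

End Metrizable.

Section Green.
Variable S : semigroupType.
Implicit Types a b : S.

Definition greenL a b : Prop := range (fun s : S => s * a) = range (fun s => s * b).

Definition greenR a b : Prop := range (fun s : S => a * s) = range (fun s => b * s).

Definition greenH a b : Prop := greenL a b /\ greenR a b.

Definition Hclass a : set S := [set b | greenH a b].

End Green.

Section BandCongruence.
Variable S : semigroupType.

Definition is_band (B : semigroupType) : Prop := forall x : B, x * x = x.

Definition congruence (rho : S -> S -> Prop) : Prop :=
  Equivalence rho /\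
  (forall a b c d, rho a b -> rho c d -> rho (a * c) (b * d)).

(* pi exhibits B as the quotient S / rho and is its natural epimorphism. *)
Definition natural_epimorphism (rho : S -> S -> Prop) (B : semigroupType)
    (pi : {multiplicative S -> B}) : Prop :=
  range pi = setT /\ (forall a b, rho a b <-> pi a = pi b).

End BandCongruence.

Section TopologicalGroupOn.
Variables (S : semigroupType) (G : set S) (tau : set_system S).

Definition topology_on : Prop :=
  [/\ tau `<=` [set U | U `<=` G],
      tau G,
      forall U V, tau U -> tau V -> tau (U `&` V) &
      forall F : set_system S, F `<=` tau -> tau (\bigcup_(U in F) U)].

Definition nbhs_in (x : S) : set_system S :=
  filter_from [set U | tau U /\ U x] id.

Definition group_on (e : S) (inv : S -> S) : Prop :=
  [/\ forall x y, G x -> G y -> G (x * y),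
      G e,
      forall x, G x -> e * x = x /\ x * e = x,
      forall x, G x -> G (inv x) &
      forall x, G x -> inv x * x = e /\ x * inv x = e].

(* The values of inv outside G are irrelevant. *)
Definition topological_group_on : Prop :=
  topology_on /\
  exists (e : S) (inv : S -> S),
    [/\ group_on e inv,
        forall x y, G x -> G y ->
          (fun p : S * S => p.1 * p.2) @ (nbhs_in x, nbhs_in y)
            --> nbhs_in (x * y) &
        forall x, G x -> inv @ nbhs_in x --> nbhs_in (inv x)].

End TopologicalGroupOn.

Definition band_of_topological_groups (S : topologicalSemigroupType)
    (B : semigroupType) (G : B -> set S) (tau : B -> set_system S) : Prop :=
  exists (rho : S -> S -> Prop) (pi : {multiplicative S -> B}),
    [/\ congruence rho /\ is_band B,
        natural_epimorphism rho pi,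
        forall alpha, G alpha = pi @^-1` [set alpha],
        forall alpha, topological_group_on (G alpha) (tau alpha) &
        basis (\bigcup_alpha tau alpha)].

Definition is_band_of_topological_groups (S : topologicalSemigroupType) : Prop :=
  exists (B : semigroupType) (G : B -> set S) (tau : B -> set_system S),
    band_of_topological_groups G tau.

(* Main.v *)
Require Import Defs.
From mathcomp Require Import all_boot all_order all_algebra.
From mathcomp Require Import all_classical all_reals topology.

(** The underlying topology is a disjoint sum, and the summands are exactly
    the H-classes.

    Each rho-class is open, being a member of the given base, so [S] is the
    disjoint union of the open fibres of its natural projection [pi] onto the
    band.  These fibres are the H-classes ([Hclass_fibre]): two elements of a
    group are multiples of each other on both sides, so a fibre lies in one
    H-class; conversely [pi] carries H-related elements to H-related elements
    of a band, and there they coincide, since x = u y gives x y = x while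
    y = x v gives x y = y.

    It remains to see that a topological sum of metrizable spaces is metrizable
    ([metrizable_open_fibres]): truncate the metric of each summand at 1 and
    put distinct summands at distance 1.  The other direction is the
    restriction of a metric to a subspace ([metrizable_set_type]). *)

Set Implicit Arguments.
Unset Strict Implicit.
Unset Printing Implicit Defensive.

Import Order.TTheory GRing.Theory Num.Theory.

Local Open Scope classical_set_scope.

(** * Metrizable subspaces and topological sums *)

Section Metrizability.
Local Open Scope ring_scope.
Variable R : realType.

Lemma metric_ge0 (T : Type) (d : T -> T -> R) (x y : T) :
  is_metric d -> 0 <= d x y.
Proof.
case=> d0 dC dD; have := dD x y x.
by rewrite (dC y x) ((d0 x x).2 erefl) -mulr2n pmulrn_lge0.
Qed.

Lemma metrizable_set_type (T : topologicalType) (A : set T) :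
  metrizable R T -> metrizable R (set_type A).
Proof.
case=> d [[d0 dC dD] dopen].
exists (fun x y => d (set_val x) (set_val y)); split.
  split=> [x y|x y|x y z]; [|exact: dC|exact: dD].
  by rewrite d0; split=> [/val_inj|->].
move=> U; split=> [[V oV <-] x Vx|Uball].
  by have [e e0 xV] := (dopen V).1 oV _ Vx; exists e => // y; apply: xV.
(* A union of ambient balls, hence open by the triangle inequality, although
   the centres stay in [A]. *)
pose V : set T := [set y | exists x e, [/\ U x, d (set_val x) y < e &
  forall z : set_type A, d (set_val x) (set_val z) < e -> U z]].
exists V.
  apply/dopen => y [x [e [Ux xy xU]]].
  exists (e - d (set_val x) y); first by rewrite subr_gt0.
  move=> z /= yz; exists x, e; split=> //.
  by apply: le_lt_trans (dD _ y _) _; rewrite addrC -ltrBrDr.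
apply/seteqP; split=> [y [x [e [_ xy xU]]]|x Ux]; first exact: xU.
have [e e0 xU] := Uball x Ux; exists x, e; split=> //.
by rewrite ((d0 _ _).2 erefl).
Qed.

(** Transferring the metric of an open subspace to a function on the whole
    space removes the subtype, so that the metrics of different subspaces can
    be glued without transporting points between types. *)
Lemma metrizable_open_subset (T : topologicalType) (A : set T) :
    open A -> metrizable R (set_type A) ->
  exists d : T -> T -> R,
    [/\ forall x y, A x -> A y -> 0 <= d x y,
        forall x y, A x -> A y -> (d x y = 0 <-> x = y),
        forall x y, A x -> A y -> d x y = d y x,
        forall x y z, A x -> A y -> A z -> d x z <= d x y + d y z &
        forall U, U `<=` A -> (open U <-> forall x, U x ->
          exists2 e, 0 < e & forall y, A y -> d x y < e -> U y)].
Proof.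
move=> oA [d [dm dopen]]; have [d0 dC dD] := dm.
pose d' x y := if pselect (A x) is left Ax then
  if pselect (A y) is left Ay then d (SigSub (mem_set Ax)) (SigSub (mem_set Ay))
  else 0 else 0.
have d'E x y (Ax : A x) (Ay : A y) :
    d' x y = d (SigSub (mem_set Ax)) (SigSub (mem_set Ay)).
  rewrite /d'; case: pselect => // Ax'; case: pselect => // Ay'.
  by congr (d _ _); apply: val_inj.
exists d'; split.
- by move=> x y Ax Ay; rewrite d'E; apply: metric_ge0.
- move=> x y Ax Ay; rewrite d'E d0; split=> [/(congr1 val)//|xy].
  exact: val_inj.
- by move=> x y Ax Ay; rewrite !d'E; apply: dC.
- by move=> x y z Ax Ay Az; rewrite !d'E; apply: dD.
- move=> U UA.
  have -> : open U <-> open ((set_val : set_type A -> T) @^-1` U).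
    split=> [oU|[V oV VU]]; first by exists U.
    suff -> : U = V `&` A by apply: openI.
    apply/seteqP; split=> [x Ux|x [Vx Ax]].
      have Ax := UA _ Ux; split=> //.
      have : ((set_val : set_type A -> T) @^-1` U) (SigSub (mem_set Ax)) by [].
      by rewrite -VU.
    have : ((set_val : set_type A -> T) @^-1` V) (SigSub (mem_set Ax)) by [].
    by rewrite VU.
  rewrite dopen; split=> [Uball x Ux|Uball [x xA] Ux].
    have Ax := UA _ Ux; have [e e0 xU] := Uball (SigSub (mem_set Ax)) Ux.
    exists e => // y Ay; rewrite d'E => xy.
    exact: (xU (SigSub (mem_set Ay)) xy).
  have [e e0 xU] := Uball x Ux; exists e => // -[y yA] xy.
  apply: xU; first exact: set_mem yA.
  rewrite (d'E _ _ (set_mem xA) (set_mem yA)).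
  by congr (_ < _): xy; congr (d _ _); apply: val_inj.
Qed.

(** Distance 1 between fibres makes every ball of radius at most 1 stay inside
    one fibre, so that balls see only the topology of the fibres. *)
Lemma metrizable_open_fibres (T : topologicalType) (B : Type) (f : T -> B) :
    (forall b, open (f @^-1` [set b])) ->
    (forall b, metrizable R (set_type (f @^-1` [set b]))) ->
  metrizable R T.
Proof.
move=> oF mF.
have [D DP] := choice (fun b => metrizable_open_subset (oF b) (mF b)).
pose d x y : R := if pselect (f x = f y) then Num.min 1 (D (f x) x y) else 1.
have dE x y : f x = f y -> d x y = Num.min 1 (D (f x) x y).
  by rewrite /d; case: pselect.
have dN x y : f x <> f y -> d x y = 1 by rewrite /d; case: pselect.
have d_ge0 x y : 0 <= d x y.
  have [xy|xy] := pselect (f x = f y); last by rewrite dN.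
  have [D0 _ _ _ _] := DP (f x).
  by rewrite dE // le_min ler01 D0 //=.
have d_le1 x y : d x y <= 1.
  have [xy|xy] := pselect (f x = f y); last by rewrite dN.
  by rewrite dE // ge_min lexx.
have d_ltD x y e : 0 < e -> d x y < Num.min 1 e -> f x = f y /\ D (f x) x y < e.
  rewrite lt_min => e0 /andP[]; have [xy|xy] := pselect (f x = f y); last first.
    by rewrite dN // ltxx.
  rewrite dE // !gt_min ltxx /= => D1 /orP[e1|]; last by [].
  by split=> //; apply: lt_trans e1.
exists d; split; first split.
- move=> x y; have [xy|xy] := pselect (f x = f y); last first.
    rewrite dN //; split=> [/eqP|xy']; first by rewrite oner_eq0.
    by case: xy; rewrite xy'.
  have [_ D0 _ _ _] := DP (f x).
  rewrite dE // -(D0 x y) //=; split=> [|->]; last by rewrite min_r.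
  by case: leP => // _ /eqP; rewrite oner_eq0.
- move=> x y; have [xy|xy] := pselect (f x = f y); last first.
    by rewrite (dN _ _ xy) (dN _ _ (nesym xy)).
  have [_ _ DC _ _] := DP (f x).
  by rewrite (dE _ _ xy) (dE _ _ (esym xy)) -xy DC.
- move=> x y z; have [xy|xy] := pselect (f x = f y); last first.
    by rewrite (dN _ _ xy); apply: le_trans (d_le1 _ _) _; rewrite lerDl.
  have [yz|yz] := pselect (f y = f z); last first.
    by rewrite (dN _ _ yz); apply: le_trans (d_le1 _ _) _; rewrite lerDr.
  have [D0 _ _ DD _] := DP (f x).
  have Dxy : 0 <= D (f x) x y by apply: D0.
  have Dyz : 0 <= D (f x) y z by apply: D0 => //=; rewrite -yz.
  have Dxz : D (f x) x z <= D (f x) x y + D (f x) y z.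
    by apply: DD => //=; rewrite -yz.
  rewrite (dE _ _ (etrans xy yz)) (dE _ _ xy) (dE _ _ yz) -xy.
  case: (leP 1 (D _ x y)) => [_|_].
    by rewrite ge_min lerDl le_min ler01 Dyz.
  case: (leP 1 (D _ y z)) => [_|_]; first by rewrite ge_min lerDr Dxy.
  by rewrite ge_min Dxz orbT.
- move=> U; split=> [oU x Ux|Uball].
    have [_ _ _ _ Dopen] := DP (f x).
    have UxU : U `&` f @^-1` [set f x] `<=` f @^-1` [set f x] by apply: subIsetr.
    have [e e0 xU] := (Dopen _ UxU).1 (openI oU (oF _)) x (conj Ux erefl).
    exists (Num.min 1 e); first by rewrite lt_min ltr01.
    by move=> y /= /(d_ltD _ _ _ e0)[xy Dxy]; case: (xU y).
  have -> : U = \bigcup_b (U `&` f @^-1` [set b]).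
    by apply/seteqP; split=> [x Ux|x [b _ []] //]; exists (f x).
  apply: bigcup_open => b _; have [_ _ _ _ Dopen] := DP b.
  apply/Dopen; first exact: subIsetr.
  move=> x [Ux /= xb]; have [e e0 xU] := Uball x Ux; exists e => // y yb Dxy.
  split=> //; apply: xU => /=; rewrite dE ?xb ?yb //.
  by rewrite gt_min Dxy orbT.
Qed.

End Metrizability.

(** * The H-classes of a band of groups *)

Section HClasses.
Local Open Scope group_scope.

(** An idempotent lies in its own principal one-sided ideals, which supplies
    the multipliers that Green's relations give in a monoid. *)
Lemma band_greenH_eq (B : semigroupType) (x y : B) :
  is_band B -> greenH x y -> x = y.
Proof.
move=> idB [xLy xRy].
have [u _ xE] : range (fun s : B => s * y) x by rewrite -xLy; exists x.
have [v _ yE] : range (fun s : B => x * s) y by rewrite xRy; exists y.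
have xy_x : x * y = x by rewrite -xE -mulgA idB.
have xy_y : x * y = y by rewrite -yE mulgA idB.
by rewrite -xy_x.
Qed.

(** Surjectivity makes the image of the ideal S x equal to B (f x); without it
    the multipliers in B need not come from S. *)
Lemma multiplicative_greenH (S B : semigroupType) (f : {multiplicative S -> B})
    (x y : S) :
  range f = setT -> greenH x y -> greenH (f x) (f y).
Proof.
move=> fT [xLy xRy]; have fS b : exists s, f s = b.
  by have [s _ <-] : range f b by [rewrite fT]; exists s.
have imL z : range (fun b : B => b * f z) = f @` range (fun s : S => s * z).
  apply/seteqP; split=> [_ [b _ <-]|_ [_ [s _ <-] <-]].
    by have [s <-] := fS b; exists (s * z); [exists s|rewrite gmulfM].
  by exists (f s) => //; rewrite gmulfM.
have imR z : range (fun b : B => f z * b) = f @` range (fun s : S => z * s).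
  apply/seteqP; split=> [_ [b _ <-]|_ [_ [s _ <-] <-]].
    by have [s <-] := fS b; exists (z * s); [exists s|rewrite gmulfM].
  by exists (f s) => //; rewrite gmulfM.
by split; rewrite /greenL /greenR ?imL ?imR ?xLy ?xRy.
Qed.

Lemma group_on_greenH (S : semigroupType) (G : set S) (e : S) (inv : S -> S)
    (x y : S) :
  group_on G e inv -> G x -> G y -> greenH x y.
Proof.
case=> _ _ Ge _ Ginv.
have subL a b : G a -> G b ->
    range (fun s : S => s * a) `<=` range (fun s => s * b).
  move=> Ga Gb _ [s _ <-]; exists (s * a * inv b) => //.
  by rewrite -mulgA (Ginv b Gb).1 -mulgA (Ge a Ga).2.
have subR a b : G a -> G b ->
    range (fun s : S => a * s) `<=` range (fun s => b * s).
  move=> Ga Gb _ [s _ <-]; exists (inv b * (a * s)) => //.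
  by rewrite mulgA (Ginv b Gb).2 mulgA (Ge a Ga).1.
by move=> Gx Gy; split; apply/seteqP; split; auto.
Qed.

Lemma Hclass_fibre (S B : semigroupType) (f : {multiplicative S -> B}) (a : S) :
    is_band B -> range f = setT ->
    (forall b, exists e inv, group_on (f @^-1` [set b]) e inv) ->
  Hclass a = f @^-1` [set f a].
Proof.
move=> idB fT gF; apply/seteqP; split=> [x /(multiplicative_greenH fT)|x /= fx].
  by move=> /(band_greenH_eq idB) /esym.
by have [e [inv ge]] := gF (f a); apply: group_on_greenH ge _ _.
Qed.

End HClasses.

Theorem theorem4p13 (R : realType) (S : topologicalSemigroupType)
    (hS : is_band_of_topological_groups S) :
  metrizable R S <-> (forall a : S, metrizable R (set_type (Hclass a))).
Proof.
split=> [mS a|mH]; first exact: metrizable_set_type.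
case: hS => B [G [tau [rho [pi [[_ idB] [piT _] GE tgG [tau_open _]]]]]].
apply: (@metrizable_open_fibres R S B pi) => b.
  rewrite -GE; apply: tau_open; exists b => //.
  by have [[]] := tgG b.
have [a _ <-] : range pi b by rewrite piT.
rewrite -(Hclass_fibre a idB piT) // => c.
have [_ [e [inv [gG _ _]]]] := tgG c.
by exists e, inv; rewrite -GE.
Qed.
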